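(* Let $k \in \mathbb{N}$, and let $\lambda$ be a finite pointed poset of degree $\ell$ and height $n$. Then the Strategy (described in the context), applied to $\lambda$ with limit $k$, guarantees identification of the hidden ideal $\mu$ of $\lambda$ (for every ideal $\mu$ of $\lambda$), using at most $k$ positive queries and at most $$f_{k,\ell}(n) := \sum_{i=0}^{\lceil n/k \rceil-1} \ell^i + \sum_{j=1}^{k-1} \ell^{\lceil (n-j)/k\rceil}$$ total queries. Moreover, $$f_{k,\ell}(n) \leq \begin{cases} \left\lceil \frac{n}{k}\right\rceil + k - 1 & \text{if } \ell = 1;\\ k\,\ell^{\lceil n/k \rceil} & \text{if } \ell > 1.\end{cases}$$
   Context: $\mathbb{N}=\mathbb{Z}_{>0}$ and $0^0=1$. All posets are finite. A poset $\lambda$ (with order $\succcurlyeq$) is pointed if for all $a,b\in\lambda$ there is $c\in\lambda$ with $a\succcurlyeq c$ and $b\succcurlyeq c$; equivalently (for finite posets), $\lambda=\varnothing$ or $\lambda$ has a unique minimal element. For $v\in\lambda$: $\lambda_{\succcurlyeq v}=\{u\in\lambda\mid u\succcurlyeq v\}$, $\lambda_{\preccurlyeq v}=\{u\in\lambda\mid u\preccurlyeq v\}$, $\lambda_{\not\succcurlyeq v}=\{u\in\lambda\mid u\not\succcurlyeq v\}$, each with the inherited order. An ideal of $\lambda$ is a subset equal to $\varnothing$ or to $\lambda_{\preccurlyeq v}$ for some $v\in\lambda$. The degree of $v\in \lambda$ is the number of elements of $\lambda$ covering $v$; the degree of $\lambda$ is the maximum of the degrees of its elements ($0$ if $\lambda=\varnothing$).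 A maximal $\lambda$-chain (or ''maximal chain in $\lambda$'') means a chain in $\lambda$ of maximum cardinality. The height $\mathrm{ht}(\lambda)$ is the cardinality of a maximal $\lambda$-chain, and the height $\mathrm{ht}(v)$ of $v\in\lambda$ is the maximum cardinality of a chain in $\lambda$ with top element $v$ (so the minimal element of a pointed poset has height $1$). Hidden ideal problem: the poset $\lambda^0$ is known, $\mu$ is an unknown ideal of $\lambda^0$. One may sequentially (adaptively) query elements $v\in\lambda^0$, learning whether $v\in\mu$ (a positive query) or $v\notin\mu$ (a negative query). At most a given number $k^0\in \mathbb{N}$ of positive query results is permitted. The goal is to identify $\mu$. The Strategy, for input $(\lambda^0,k^0)$ with $\lambda^0$ pointed: set $\lambda:=\lambda^0$, $k:=k^0$ and repeat the following round on the current pair $(\lambda,k)$; all heights and maximal chains below are computed in the current $\lambda$. (1) If $\lambda=\varnothing$, terminate with answer $\mu=\varnothing$. (2) If $\lambda=\{v\}$, query $v$; terminate with answer $\mu=\lambda^0_{\preccurlyeq v}$ if $v\in\mu$, and $\mu=\varnothing$ if $v\notin\mu$. (3) If $|\lambda|>1$, set $n:=\mathrm{ht}(\lambda)$ and choose a node $v$ as follows: if $k=1$, $v$ is any node of height $n$; if $k\geq n$, $v$ is any node of height $2$ belonging to a maximal chain in $\lambda$; if $1<k<n$, $v$ is any node of height $\lceil\frac{n+1}{k}\rceil$ belonging to a maximal chain in $\lambda$. Query $v$. If $v\in\mu$, replace $\lambda$ by $\lambda_{\succcurlyeq v}$ and $k$ by $k-1$; then, if the new $\lambda$ has exactly one element,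 terminate with answer $\mu=\lambda^0_{\preccurlyeq v}$, and otherwise start a new round. If $v\notin\mu$, replace $\lambda$ by $\lambda_{\not\succcurlyeq v}$, keep $k$, and start a new round. The guarantees are for every admissible sequence of choices of the nodes $v$. *)

(* Defs.v *)
From mathcomp Require Import all_boot all_order.

Set Implicit Arguments.
Unset Strict Implicit.
Unset Printing Implicit Defensive.

(* The ambient poset is a [finPOrderType];
   its subposets are sets [L : {set T}] carrying the inherited order. *)

Section Poset.
Context {d : Order.disp_t} {T : finPOrderType d}.
Implicit Types (L C mu : {set T}) (u v w : T) (k : nat).

Definition pointed L : Prop :=
  forall a b, a \in L -> b \in L -> exists2 c, c \in L & (c <= a)%O && (c <= b)%O.

Definition up L v : {set T} := [set u in L | (v <= u)%O].
Definition down L v : {set T} := [set u in L | (u <= v)%O].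
Definition not_up L v : {set T} := [set u in L | ~~ (v <= u)%O].

Definition ideal L mu : Prop :=
  mu = set0 \/ exists2 v, v \in L & mu = down L v.

Definition covers L u v : bool :=
  [&& u \in L, v \in L, (v < u)%O & ~~ [exists w in L, (v < w < u)%O]].

Definition node_degree L v : nat := #|[set u | covers L u v]|.
Definition degree L : nat := \max_(v in L) node_degree L v.

Definition chain L C : bool :=
  (C \subset L) && [forall x in C, forall y in C, (x >=< y)%O].

Definition height L : nat := \max_(C : {set T} | chain L C) #|C|.

Definition top_of C v : bool := (v \in C) && [forall x in C, (x <= v)%O].

Definition node_height L v : nat :=
  \max_(C : {set T} | chain L C && top_of C v) #|C|.

(* Maximal means of maximum cardinality, not merely inclusion-maximal. *)
Definition maximal_chain L C : bool := chain L C && (#|C| == height L).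

Definition on_maximal_chain L v : bool :=
  [exists C : {set T}, maximal_chain L C && (v \in C)].

(* The ceiling of m / k, for k > 0. *)
Definition ceil_div (m k : nat) : nat := (m + k.-1) %/ k.

(* The nodes which may be queried when #|L| > 1.  There are none if k = 0. *)
Definition admissible L k v : bool :=
  let n := height L in
  (v \in L) &&
  [|| (k == 1) && (node_height L v == n),
      [&& n <= k, node_height L v == 2 & on_maximal_chain L v]
    | [&& 1 < k < n, node_height L v == ceil_div n.+1 k
        & on_maximal_chain L v]].

(* [Active L k] is the current pair of the Strategy; [Answer A] is termination
   with the answer A. *)
Inductive state := Active of {set T} & nat | Answer of {set T}.

(* [round L0 oracle s q s']: one round of the Strategy for the input poset L0
   can lead from s to s' while making the queries q, each recorded with its
   result.  The hidden ideal enters only through [oracle], which is evaluated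
   only at the queried node. *)
Inductive round (L0 : {set T}) (oracle : pred T) :
    state -> seq (T * bool) -> state -> Prop :=
| RoundEmpty k :
    round L0 oracle (Active set0 k) [::] (Answer set0)
| RoundSingle v k :
    round L0 oracle (Active [set v] k) [:: (v, oracle v)]
      (Answer (if oracle v then down L0 v else set0))
| RoundPos L k v :
    1 < #|L| -> admissible L k v -> oracle v ->
    round L0 oracle (Active L k) [:: (v, true)]
      (if #|up L v| == 1 then Answer (down L0 v) else Active (up L v) k.-1)
| RoundNeg L k v :
    1 < #|L| -> admissible L k v -> ~~ oracle v ->
    round L0 oracle (Active L k) [:: (v, false)] (Active (not_up L v) k).

(* [run L0 k0 oracle h s]: some sequence of admissible choices leads the
   Strategy from the input (L0, k0) to s, with query history h. *)
Inductive run (L0 : {set T}) (k0 : nat) (oracle : pred T) :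
    seq (T * bool) -> state -> Prop :=
| RunInit : run L0 k0 oracle [::] (Active L0 k0)
| RunRound h s q s' :
    run L0 k0 oracle h s -> round L0 oracle s q s' ->
    run L0 k0 oracle (h ++ q) s'.

Definition positive_queries (h : seq (T * bool)) : nat := count snd h.
Definition total_queries (h : seq (T * bool)) : nat := size h.

(* There is no infinite run from the input (L0, k0). *)
Definition strategy_terminates (L0 : {set T}) (k0 : nat) (oracle : pred T) :
    Prop :=
  Acc (fun s' s => exists q, round L0 oracle s q s') (Active L0 k0).

(* Whatever the choices, the Strategy terminates, never lacks an admissible
   query before giving an answer, and the answer is mu. *)
Definition strategy_identifies (L0 : {set T}) (k0 : nat) mu : Prop :=
  strategy_terminates L0 k0 (mem mu) /\
  forall h s, run L0 k0 (mem mu) h s ->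
    s = Answer mu \/ exists q s', round L0 (mem mu) s q s'.

End Poset.

(* Truncated subtraction is harmless: for n < j < k the ceiling of (n - j) / k
   is 0, as is [ceil_div (n - j) k].  In ssrnat, 0 ^ 0 = 1. *)
Definition query_bound (k l n : nat) : nat :=
  \sum_(0 <= i < ceil_div n k) l ^ i
  + \sum_(1 <= j < k) l ^ ceil_div (n - j) k.

(* Main.v *)
Require Import Defs.
From mathcomp Require Import all_boot all_order.
From mathcomp Require Import zify.

(* Write n for the height of the current poset, m = ceil((n+1)/k) for the
   height of the queried node, and f_k(n) for the query bound.  For 1 < k < n
   one has f_k(n) = l^(m-1) + f_(k-1)(n+1-m).  A pointed poset of degree at
   most l has at most l^(m-1) nodes of height m, so the first summand should
   pay for the negative queries before the next positive one, which leaves a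
   poset of height at most n+1-m.  Negative queries may lower n, and hence m;
   this is harmless if f_k(n') <= f_(k-1)(n+1-m) for the new height n'.  For
   l > 1 the only exception is n' = n-1 with k dividing n, where m drops by
   one and f_k(n') is too large.  This is why, when k divides n, the potential
   counts the covering pairs between heights m-1 and m instead of nodes of
   height m: there are at most l^(m-1) of them, every negative query removes
   one, and after the drop each node of height m-1 on a maximal chain lies in
   one of those that remain.  For l = 1 the poset is a chain, and a negative
   query makes the height drop below m.  For k >= n > 1 each positive query
   lowers n and follows at most l - 1 negative ones, and for k = 1 every
   negative query discards a node. *)

Set Implicit Arguments.
Unset Strict Implicit.
Unset Printing Implicit Defensive.

Import Order.POrderTheory.

(** * The query bound *)

Lemma ceil_divE a k c : a <= c * k < a + k -> ceil_div a k = c.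
Proof.
move=> H; rewrite /ceil_div; apply/eqP; rewrite eqn_leq.
rewrite -ltnS ltn_divLR ?leq_divRL; nia.
Qed.

Lemma ceil_div_bounds a k : 0 < k -> a <= ceil_div a k * k < a + k.
Proof.
by move=> k0; rewrite /ceil_div; have := divn_eq (a + k.-1) k;
   have := ltn_pmod (a + k.-1) k0; lia.
Qed.

Lemma ceil_div_mono k : {homo ceil_div^~ k : a b / a <= b}.
Proof. by move=> a b ab; rewrite /ceil_div leq_div2r // leq_add2r. Qed.

Lemma query_bound_mono k l : 0 < l -> {homo query_bound k l : a b / a <= b}.
Proof.
move=> l0 a b ab; rewrite /query_bound leq_add //.
  rewrite [X in _ <= X](big_cat_nat (leq0n _) (ceil_div_mono k ab)) /=.
  exact: leq_addr.
by apply: leq_sum => j _; apply: leq_pexp2l => //; apply: ceil_div_mono; apply: leq_sub2r.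
Qed.

(** For [n = q * k + s + 1] the ceiling of [(n - j) / k] is [q + 1] while [j <= s] and [q] for
    [s < j < k]. The last term [l ^ q] of the geometric sum joins the latter group, which gives
    [k - s] copies. *)
Lemma query_boundE k l q s : s < k ->
  query_bound k l (q * k + s.+1) =
  \sum_(0 <= i < q) l ^ i + s * l ^ q.+1 + (k - s) * l ^ q.
Proof.
move=> sk; rewrite /query_bound (@ceil_divE _ _ q.+1); last lia.
rewrite big_nat_recr //= (@big_cat_nat _ _ _ s.+1 1 k) //=.
have -> : \sum_(1 <= j < s.+1) l ^ ceil_div (q * k + s.+1 - j) k = s * l ^ q.+1.
  rewrite -[s in RHS]subn0 -subSS -sum_nat_const_nat; apply: eq_big_nat => j jB.
  by rewrite (@ceil_divE _ _ q.+1) //; lia.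
have -> : \sum_(s.+1 <= j < k) l ^ ceil_div (q * k + s.+1 - j) k = (k - s.+1) * l ^ q.
  rewrite -sum_nat_const_nat; apply: eq_big_nat => j jB.
  by rewrite (@ceil_divE _ _ q) //; nia.
have -> : k - s = (k - s.+1).+1 by lia.
rewrite mulSn; lia.
Qed.

Lemma query_bound_gt0 k l n : 0 < k -> 0 < n -> 0 < query_bound k l n.
Proof.
move=> k0 n0; have := ceil_div_bounds n k0.
rewrite /query_bound; case: (ceil_div n k) => [|c] cB; first lia.
by rewrite big_nat_recl.
Qed.

Lemma query_bound1 l n : query_bound 1 l n = \sum_(0 <= i < n) l ^ i.
Proof. by rewrite /query_bound (@ceil_divE _ _ n) ?[X in _ + X]big_geq ?addn0 //; lia. Qed.

Lemma query_bound_few k l n : 0 < n <= k -> 1 + n.-1 * l <= query_bound k l n.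
Proof.
case: n => //= n nk; have := @query_boundE k l 0 n nk.
by rewrite big_geq // mul0n add0n expn1 expn0 => ->; lia.
Qed.

(** Dividing [n - 1] instead of [n] keeps [s + 1] between 1 and [k], so that the ceiling of [n / k]
    is always [q + 1]; [k] divides [n] exactly when [s + 1 = k]. *)
Lemma split_pred k n : 0 < k < n -> exists q s, [/\ s < k, 0 < q & n = q * k + s.+1].
Proof.
move=> kn; exists (n.-1 %/ k), (n.-1 %% k); split.
- by rewrite ltn_pmod; lia.
- by rewrite divn_gt0; lia.
- by rewrite addnS -divn_eq; lia.
Qed.

Lemma ceil_div_query_height k q s : 1 < k -> s < k ->
  ceil_div (q * k + s.+1).+1 k = q.+1 + (s.+1 == k).
Proof. by move=> k1 sk; apply: ceil_divE; case: eqP => ?; nia. Qed.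

(** Compare closed forms. If [k] does not divide [n], the new height has the same [q] and [s] with
    respect to [k - 1], and one [l ^ q] is lost. If [k] divides [n], then [s] drops by one and one
    [l ^ q.+1] is lost. *)
Lemma query_bound_rec k l n : 1 < k < n ->
  query_bound k l n =
  l ^ (ceil_div n.+1 k).-1 + query_bound k.-1 l (n.+1 - ceil_div n.+1 k).
Proof.
move=> /andP[k1 kn]; have [|q [s [sk q0 ->]]] := @split_pred k n; first lia.
rewrite ceil_div_query_height // query_boundE //.
case: eqP => [sE|sE].
  have -> : (q * k + s.+1).+1 - (q.+1 + true) = q * k.-1 + s by nia.
  case: s sk sE => [|s] sk sE; first lia.
  rewrite query_boundE; last lia.
  rewrite addn1 /= -sE /=.
  have [-> ->] : s.+2 - s.+1 = 1 /\ s.+1 - s = 1 by lia.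
  nia.
have -> : (q * k + s.+1).+1 - (q.+1 + false) = q * k.-1 + s.+1 by nia.
rewrite query_boundE; last lia.
rewrite addn0 /=; have -> : k - s = (k.-1 - s).+1 by lia.
nia.
Qed.

(** By monotonicity only the largest [n'] matters: [n - 1], or [n - 2] if [k] divides [n]. The right
    side exceeds the left by [l ^ q.+1 - 2 * l ^ q], or by 0 when this [n'] is [q * k]. *)
Lemma query_bound_drop k l n n' : 1 < k < n -> 1 < l ->
  n' + (k %| n) < n ->
  query_bound k l n' <= query_bound k.-1 l (n.+1 - ceil_div n.+1 k).
Proof.
move=> /andP[k1 kn] l1; have [|q [s [sk q0 ->]]] := @split_pred k n; first lia.
have -> : (k %| q * k + s.+1) = (s.+1 == k).
  rewrite dvdn_addr ?dvdn_mull //; apply/idP/eqP => [/dvdn_leq|->//]; lia.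
have qE : q = q.-1.+1 by lia.
(* A multiple of [k] has quotient [q - 1] and offset [k - 1] in [query_boundE]; its single
   [l ^ q.-1] completes the geometric sum. *)
have fqk : query_bound k l (q * k) = \sum_(0 <= i < q) l ^ i + k.-1 * l ^ q.
  have -> : q * k = q.-1 * k + k.-1.+1 by nia.
  rewrite query_boundE; last lia.
  have -> : k - k.-1 = 1 by lia.
  by rewrite [in RHS]qE big_nat_recr //=; lia.
rewrite ceil_div_query_height //; case: eqP => [sE|sE] ltn'.
  have -> : (q * k + s.+1).+1 - (q.+1 + true) = q * k.-1 + s by nia.
  case: s sk sE ltn' => [|s] sk sE ltn'; first lia.
  rewrite query_boundE; last lia.
  have n'B : n' <= q * k + s by lia.
  apply: leq_trans (query_bound_mono _ _ n'B) _; first lia.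
  have -> : k.-1 - s = 1 by lia.
  case: s sk sE {ltn' n'B} => [|s] sk sE; first by rewrite addn0 fqk; lia.
  rewrite query_boundE; last lia.
  have -> : k - s = 3 by lia.
  rewrite expnS; nia.
have -> : (q * k + s.+1).+1 - (q.+1 + false) = q * k.-1 + s.+1 by nia.
rewrite query_boundE; last lia.
have n'B : n' <= q * k + s by lia.
apply: leq_trans (query_bound_mono _ _ n'B) _; first lia.
case: s sk sE {ltn' n'B} => [|s] sk sE; first by rewrite addn0 fqk; lia.
rewrite query_boundE; last lia.
have -> : k - s = (k.-1 - s.+1).+2 by lia.
rewrite expnS; nia.
Qed.

Lemma query_bound_unary k n : 0 < k -> query_bound k 1 n = ceil_div n k + k.-1.
Proof.
move=> k0; rewrite /query_bound; congr (_ + _).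
  by rewrite (eq_bigr (fun=> 1)) ?sum_nat_const_nat ?subn0 ?muln1 // => i _; rewrite exp1n.
by rewrite (eq_bigr (fun=> 1)) ?sum_nat_const_nat ?muln1 ?subn1 // => i _; rewrite exp1n.
Qed.

(** As [n' < m] forces [n' + k <= n], the ceiling in [query_bound_unary] drops by at least one, and
    1 is all that [query_bound_rec] takes away for [l = 1]. *)
Lemma query_bound_drop_unary k n n' : 1 < k < n -> n' < ceil_div n.+1 k ->
  query_bound k 1 n' <= query_bound k.-1 1 (n.+1 - ceil_div n.+1 k).
Proof.
move=> kn n'B; have := @query_bound_rec k 1 n kn; rewrite exp1n.
suff : query_bound k 1 n' < query_bound k 1 n by lia.
rewrite !query_bound_unary; [|lia|lia].
have n'n : n' + k <= n.
  have /(ceil_div_bounds n.+1) : 0 < k by lia.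
  nia.
have : ceil_div (n' + k) k <= ceil_div n k by apply: ceil_div_mono.
rewrite {1}/ceil_div -addnA [k + _]addnC addnA divnDr ?dvdnn // divnn.
rewrite -/(ceil_div n' k); lia.
Qed.

Lemma sum_expn_le l c : 1 < l -> \sum_(0 <= i < c) l ^ i <= l ^ c.
Proof.
move=> l1; elim: c => [|c IH]; first by rewrite big_geq.
rewrite big_nat_recr //= expnS; nia.
Qed.

Lemma query_bound_le k l n : 0 < k -> 1 < l -> query_bound k l n <= k * l ^ ceil_div n k.
Proof.
move=> k0 l1; rewrite /query_bound -[k in k * _]prednK // mulSn.
apply: leq_add; first exact: sum_expn_le.
rewrite -subn1 -sum_nat_const_nat; apply: leq_sum => j _.
by apply: leq_pexp2l; [lia|apply: ceil_div_mono; apply: leq_subr].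
Qed.

(** Only zeroth powers of [l] occur when [n <= 1], and there [0 ^ 0 = 1]. *)
Lemma query_bound_degenerate k l l' n : 0 < k -> n <= 1 ->
  query_bound k l n = query_bound k l' n.
Proof.
move=> k0 n1; rewrite /query_bound; congr (_ + _); apply: eq_big_nat => i iB.
  have ? := ceil_div_bounds n k0.
  have -> : i = 0 by nia.
  by [].
by rewrite (@ceil_divE _ _ 0) //; lia.
Qed.

Lemma query_height_bounds k n : 1 < k < n -> 1 < ceil_div n.+1 k <= n.
Proof.
move=> kn; have /(ceil_div_bounds n.+1) : 0 < k by lia.
nia.
Qed.

(** * Heights in finite posets *)

Lemma card_bigcup_le (I T : finType) (P : pred I) (F : I -> {set T}) :
  #|\bigcup_(i | P i) F i| <= \sum_(i | P i) #|F i|.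
Proof.
elim/big_rec2: _ => [|i m A _ IH]; first by rewrite cards0.
by apply: leq_trans (leq_card_setU _ _) _; rewrite leq_add2l.
Qed.

Section Posets.
Context {d : Order.disp_t} {T : finPOrderType d}.
Implicit Types (L C mu : {set T}) (u v w x y : T) (k l h : nat).

Lemma chainP L C :
  reflect (C \subset L /\ {in C &, forall x y, (x >=< y)%O}) (chain L C).
Proof.
apply: (iffP andP) => [[CL /forall_inP cC]|[CL cC]]; split=> //.
  by move=> x y xC yC; exact: (forall_inP (cC x xC)).
by apply/forall_inP => x xC; apply/forall_inP => y yC; apply: cC.
Qed.

Lemma chain_subset L L' C C' :
  C' \subset C -> C' \subset L' -> chain L C -> chain L' C'.
Proof.
move=> C'C C'L' /chainP[_ cC]; apply/chainP; split=> // x y xC yC.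
by apply: cC; apply: (subsetP C'C).
Qed.

Lemma top_ofP C v :
  reflect (v \in C /\ {in C, forall x, (x <= v)%O}) (top_of C v).
Proof.
apply: (iffP andP) => [[vC /forall_inP H]|[vC H]]; split=> //.
exact/forall_inP.
Qed.

Lemma chain_set1 L v : v \in L -> chain L [set v].
Proof.
move=> vL; apply/chainP; split; first by rewrite sub1set.
by move=> x y /set1P-> /set1P->; apply: comparablexx.
Qed.

Lemma chain_card_le L C : chain L C -> #|C| <= height L.
Proof. by move=> cC; apply: (leq_bigmax_cond C). Qed.

Lemma chain_card_le_top L C v : chain L C -> top_of C v -> #|C| <= node_height L v.
Proof. by move=> cC tC; apply: (leq_bigmax_cond C); rewrite cC. Qed.

Lemma maximal_chain_exists L : exists C, maximal_chain L C.
Proof.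
rewrite /maximal_chain /height.
have [|C cC ->] := @eq_bigmax_cond _ (chain L) (fun C : {set T} => #|C|).
  apply/card_gt0P; exists set0; apply/chainP; split; first exact: sub0set.
  by move=> x y; rewrite inE.
by exists C; rewrite eqxx andbT.
Qed.

Lemma node_height_chain L v : v \in L ->
  exists C, [/\ chain L C, top_of C v & #|C| = node_height L v].
Proof.
move=> vL; rewrite /node_height.
have [|C /andP[cC tC] ->] :=
    @eq_bigmax_cond _ [pred C | chain L C && top_of C v] (fun C : {set T} => #|C|).
  apply/card_gt0P; exists [set v]; rewrite inE chain_set1 //.
  by apply/top_ofP; split=> [|x /set1P->]; rewrite ?set11.
by exists C.
Qed.

Lemma node_height_gt0 L v : v \in L -> 0 < node_height L v.
Proof.
move=> vL; have [C [_ /top_ofP[vC _] <-]] := node_height_chain vL.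
by apply/card_gt0P; exists v.
Qed.

Lemma node_height_le L v : node_height L v <= height L.
Proof. by apply/bigmax_leqP => C /andP[cC _]; apply: chain_card_le. Qed.

Lemma node_height_lt L u v : u \in L -> v \in L -> (u < v)%O ->
  node_height L u < node_height L v.
Proof.
move=> uL vL uv; have [C [/chainP[CL cC] /top_ofP[uC tC] <-]] := node_height_chain uL.
have Cv x : x \in C -> (x < v)%O by move=> /tC /le_lt_trans; apply.
have vC : v \notin C by apply/negP => /Cv; rewrite ltxx.
have -> : #|C|.+1 = #|v |: C| by rewrite cardsU1 vC.
apply: chain_card_le_top.
  apply/chainP; split; first by rewrite subUset sub1set vL.
  move=> x y /setU1P[->|xC] /setU1P[->|yC].
  - exact: comparablexx.
  - by rewrite comparable_sym lt_comparable // Cv.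
  - by rewrite lt_comparable // Cv.
  - exact: cC.
apply/top_ofP; split; first exact: setU11.
by move=> x /setU1P[->//|/Cv/ltW].
Qed.

Lemma comparable_le_node_height L u v : u \in L -> v \in L -> (u >=< v)%O ->
  node_height L u <= node_height L v -> (u <= v)%O.
Proof.
move=> uL vL cuv; rewrite comparable_leNgt //.
by apply: contraTN => /(node_height_lt vL uL); rewrite -ltnNge.
Qed.

Lemma comparable_lt_node_height L u v : u \in L -> v \in L -> (u >=< v)%O ->
  node_height L u < node_height L v -> (u < v)%O.
Proof.
move=> uL vL cuv huv; rewrite lt_neqAle.
rewrite (comparable_le_node_height uL vL cuv (ltnW huv)) andbT.
by apply: contraTneq huv => ->; rewrite ltnn.
Qed.

Lemma covers_of_height L u v : u \in L -> v \in L -> (u < v)%O ->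
  node_height L v <= (node_height L u).+1 -> covers L v u.
Proof.
move=> uL vL uv huv; rewrite /covers uL vL uv /=.
apply/exists_inP => -[w wL /andP[uw wv]].
have := node_height_lt uL wL uw; have := node_height_lt wL vL wv; lia.
Qed.

Lemma covers_below L v : v \in L -> 1 < node_height L v ->
  exists2 u, covers L v u & (node_height L u).+1 = node_height L v.
Proof.
move=> vL; have [C [cC /top_ofP[vC tC] hC]] := node_height_chain vL.
have := cardsD1 v C; rewrite vC hC => hD h1.
have /card_gt0P[x0 x0D] : 0 < #|C :\ v| by lia.
(* The top of the chain without [v] is found as its node of largest height: within a chain, heights
   decide the order. *)
case: (arg_maxnP (node_height L) x0D) => u uD umax.
have [uv uC] := setD1P uD; have /chainP[/subsetP CL cC'] := cC.
have uL := CL _ uC.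
have ltuv : (u < v)%O by rewrite lt_neqAle uv tC.
have hu : node_height L v <= (node_height L u).+1.
  rewrite hD; suff : #|C :\ v| <= node_height L u by lia.
  apply: chain_card_le_top.
    apply: (chain_subset _ _ cC); first exact: subsetDl.
    by apply: subset_trans (subsetDl _ _) _; apply/subsetP.
  apply/top_ofP; split=> // x xD; have [_ xC] := setD1P xD.
  by apply: (comparable_le_node_height (CL _ xC) uL (cC' x u xC uC)); apply: umax.
exists u; first exact: covers_of_height.
by apply/eqP; rewrite eqn_leq hu andbT node_height_lt.
Qed.

(** Heights are distinct along a chain and lie between 1 and [height L]; a chain with [height L]
    elements therefore takes every value in this range. *)
Lemma maximal_chain_level L C h : maximal_chain L C -> 0 < h <= height L ->
  exists2 v, v \in C & node_height L v = h.
Proof.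
move=> /andP[/chainP[/subsetP CL cC] /eqP hC] hB.
pose s := [seq node_height L v | v <- enum C].
have us : uniq s.
  rewrite map_inj_in_uniq ?enum_uniq // => x y; rewrite !mem_enum => xC yC exy.
  have := cC _ _ xC yC; rewrite /Order.comparable !le_eqVlt.
  case/orP => /orP[/eqP->//|/node_height_lt lt].
    by have := lt _ (CL _ xC) (CL _ yC); rewrite exy ltnn.
  by have := lt _ (CL _ yC) (CL _ xC); rewrite exy ltnn.
have sub : {subset s <= iota 1 (height L)}.
  move=> i /mapP[x]; rewrite mem_enum => xC ->; rewrite mem_iota.
  by rewrite node_height_gt0 ?CL //= add1n ltnS node_height_le.
have [|_ E] := uniq_min_size us sub; first by rewrite size_iota size_map -cardE hC.
have : h \in s by rewrite E mem_iota; lia.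
by case/mapP => v; rewrite mem_enum => vC ->; exists v.
Qed.

(** * Levels and the covering pairs between them *)

Definition level L h : {set T} := [set v in L | node_height L v == h].

(** The lower node comes first. Both heights are prescribed because a covering pair may skip
    levels. *)
Definition level_edges L h : {set T * T} :=
  [set p | [&& covers L p.2 p.1, (node_height L p.1).+1 == h & node_height L p.2 == h]].

Definition critical L h : {set T} := [set v in level L h | on_maximal_chain L v].

(** A common lower bound of two nodes of height 1 cannot lie strictly below either of them. *)
Lemma level1_le L : pointed L -> #|level L 1| <= 1.
Proof.
move=> pL; apply/card_le1_eqP => a b; rewrite !inE.
move=> /andP[aL /eqP ha] /andP[bL /eqP hb].
have [c cL /andP[ca cb]] := pL a b aL bL.
have min x : x \in L -> node_height L x = 1 -> (c <= x)%O -> c = x.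
  move=> xL hx; rewrite le_eqVlt => /orP[/eqP//|/node_height_lt lt].
  by have := lt _ cL xL; have := node_height_gt0 cL; lia.
by rewrite -(min a) // -(min b).
Qed.

Lemma level_edges_le L l h : degree L <= l ->
  #|level_edges L h.+1| <= l * #|level L h|.
Proof.
move=> dL; pose S := \bigcup_(u in level L h) setX [set u] [set w | covers L w u].
have /subset_leq_card/leq_trans : level_edges L h.+1 \subset S.
  apply/subsetP => -[u w]; rewrite inE /= eqSS => /and3P[cuw hu _].
  apply/bigcupP; exists u; last by rewrite !inE eqxx.
  by rewrite inE hu andbT; case/and4P: cuw.
apply; rewrite mulnC -sum_nat_const.
apply: leq_trans (card_bigcup_le _ _) _; apply: leq_sum => u.
rewrite inE => /andP[uL _]; rewrite cardsX cards1 mul1n.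
by apply: leq_trans dL; apply: (leq_bigmax_cond u).
Qed.

Lemma level_le_edges L h : #|level L h.+2| <= #|level_edges L h.+2|.
Proof.
have /subset_leq_card/leq_trans : level L h.+2 \subset [set p.2 | p in level_edges L h.+2].
  apply/subsetP => v; rewrite inE => /andP[vL /eqP hv].
  have [|u cu hu] := covers_below vL; first by rewrite hv.
  by apply/imsetP; exists (u, v) => //; rewrite inE /= cu hu hv eqxx.
by apply; apply: leq_imset_card.
Qed.

(** Every node above height 1 is the upper end of a counted pair, and every node is the lower end of
    at most [l] pairs, so each step up multiplies the bound by [l]. *)
Lemma level_le L l h : pointed L -> degree L <= l -> #|level L h.+1| <= l ^ h.
Proof.
move=> pL dL; elim: h => [|h IH]; first exact: level1_le.
apply: leq_trans (level_le_edges _ _) _.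
by apply: leq_trans (level_edges_le _ dL) _; rewrite expnS leq_mul2l IH orbT.
Qed.

Lemma level_edges_le_exp L l h : pointed L -> degree L <= l ->
  #|level_edges L h.+2| <= l ^ h.+1.
Proof.
move=> pL dL; apply: leq_trans (level_edges_le _ dL) _.
by rewrite expnS leq_mul2l level_le ?orbT.
Qed.

Lemma card_le_geometric L l : pointed L -> degree L <= l ->
  #|L| <= \sum_(0 <= i < height L) l ^ i.
Proof.
move=> pL dL; have {1}-> : L = \bigcup_(i < height L) level L i.+1.
  apply/setP => v; apply/idP/bigcupP => [vL|[i _]]; last by rewrite inE => /andP[].
  have hv := node_height_gt0 vL; have hv' := node_height_le L v.
  have lt : (node_height L v).-1 < height L by lia.
  by exists (Ordinal lt) => //; rewrite inE vL /= prednK.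
apply: leq_trans (card_bigcup_le _ _) _; rewrite big_mkord.
by apply: leq_sum => i _; apply: level_le.
Qed.

(** A chain of maximum cardinality through [u] also meets level [h + 1], and its node there covers
    [u]. A merely inclusion-maximal chain might miss that level. *)
Lemma critical_le_edges L h : 0 < h < height L ->
  #|critical L h| <= #|level_edges L h.+1|.
Proof.
move=> hB.
have /subset_leq_card/leq_trans : critical L h \subset [set p.1 | p in level_edges L h.+1].
  apply/subsetP => u; rewrite !inE => /andP[/andP[uL /eqP hu] /existsP[C /andP[mC uC]]].
  have [|w wC hw] := maximal_chain_level (h := h.+1) mC; first lia.
  have /andP[/chainP[/subsetP CL cC] _] := mC.
  have wL := CL _ wC.
  have uw : (u < w)%O.
    by apply: (comparable_lt_node_height uL wL); [apply: cC|rewrite hu hw].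
  apply/imsetP; exists (u, w) => //; rewrite inE /= hu hw !eqxx !andbT.
  by apply: covers_of_height; rewrite ?hu ?hw.
by apply; apply: leq_imset_card.
Qed.

Lemma height_subset L L' : L' \subset L -> height L' <= height L.
Proof.
move=> L'L; apply/bigmax_leqP => C cC; apply: chain_card_le.
have /chainP[CL' _] := cC; apply: (chain_subset _ _ cC) => //.
exact: subset_trans L'L.
Qed.

Lemma height_le_card L : height L <= #|L|.
Proof. by apply/bigmax_leqP => C /chainP[CL _]; apply: subset_leq_card. Qed.

Lemma height_gt0 L : 0 < #|L| -> 0 < height L.
Proof.
move=> /card_gt0P[v vL]; apply: leq_trans (node_height_le L v).
exact: node_height_gt0.
Qed.

Lemma height_gt1 L : pointed L -> 1 < #|L| -> 1 < height L.
Proof.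
move=> pL L1; rewrite ltnNge; apply/negP => hL.
have : #|L| <= #|level L 1|; last by have := level1_le pL; lia.
apply: subset_leq_card; apply/subsetP => v vL; rewrite inE vL eqn_leq node_height_gt0 //.
by rewrite andbT (leq_trans (node_height_le _ _)).
Qed.

(** * Convex subposets and the two outcomes of a query *)

Definition convex L L' : Prop := L' \subset L /\
  forall x y z, x \in L' -> z \in L' -> y \in L -> (x <= y <= z)%O -> y \in L'.

(** Nothing of [L] between two nodes of [L'] is missing from [L'], so no new covering pairs
    arise. *)
Lemma convex_covers L L' u v : convex L L' -> covers L' u v -> covers L u v.
Proof.
move=> [/subsetP L'L cL] /and4P[uL' vL' uv nw]; rewrite /covers !L'L ?uv //=.
apply: contra nw => /exists_inP[w wL wB]; apply/exists_inP; exists w => //.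
apply: (cL v w u) => //; case/andP: wB => vw wu.
by rewrite !ltW.
Qed.

Lemma convex_degree L L' : convex L L' -> degree L' <= degree L.
Proof.
move=> cL; apply/bigmax_leqP => v vL'; have [/subsetP L'L _] := cL.
apply: leq_trans (leq_bigmax_cond v (L'L _ vL')); apply: subset_leq_card.
by apply/subsetP => u; rewrite !inE; apply: convex_covers.
Qed.

Lemma up_convex L v : convex L (up L v).
Proof.
split=> [|x y z]; first by apply/subsetP => x; rewrite inE => /andP[].
rewrite !inE => /andP[_ vx] _ -> /andP[xy _].
exact: le_trans vx xy.
Qed.

Lemma not_up_convex L v : convex L (not_up L v).
Proof.
split=> [|x y z]; first by apply/subsetP => x; rewrite inE => /andP[].
rewrite !inE => _ /andP[_ nvz] -> /andP[_ yz].
by apply: contra nvz => vy; apply: le_trans vy yz.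
Qed.

Lemma up_pointed L v : v \in L -> pointed (up L v).
Proof.
move=> vL a b; rewrite !inE => /andP[_ va] /andP[_ vb].
by exists v; rewrite ?va // inE vL /=.
Qed.

Lemma not_up_pointed L v : pointed L -> pointed (not_up L v).
Proof.
move=> pL a b; rewrite !inE => /andP[aL nva] /andP[bL _].
have [c cL cab] := pL a b aL bL; exists c => //; rewrite inE cL /=.
case/andP: cab => ca _; apply: contra nva => vc.
exact: le_trans vc ca.
Qed.

(** [not_up L v] is closed downwards in [L], so it contains every chain of [L] with top [u]. This
    makes levels comparable before and after a negative query. *)
Lemma not_up_node_height L v u : u \in not_up L v ->
  node_height (not_up L v) u = node_height L u.
Proof.
rewrite inE => /andP[uL nvu]; apply/eqP; rewrite eqn_leq; apply/andP; split.
  apply/bigmax_leqP => C /andP[cC tC]; apply: chain_card_le_top => //.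
  have /chainP[CL _] := cC; apply: (chain_subset _ _ cC) => //.
  by apply: subset_trans CL (proj1 (not_up_convex _ _)).
have [C [cC tC <-]] := node_height_chain uL; apply: chain_card_le_top => //.
have /chainP[/subsetP CL _] := cC; have /top_ofP[_ Cu] := tC.
apply: (chain_subset _ _ cC) => //; apply/subsetP => x xC; rewrite inE CL //=.
apply: contra nvu => vx; exact: le_trans vx (Cu _ xC).
Qed.

(** A chain in [up L v] can be stacked on a longest chain with top [v]; the two share at most
    [v]. *)
Lemma up_height L v : v \in L -> height (up L v) + node_height L v <= (height L).+1.
Proof.
move=> vL; have [C /andP[cC /eqP <-]] := maximal_chain_exists (up L v).
have [D [cD /top_ofP[vD tD] <-]] := node_height_chain vL.
have /chainP[/subsetP CL cC'] := cC; have /chainP[/subsetP DL cD'] := cD.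
have vC x : x \in C -> (v <= x)%O by move=> /CL; rewrite inE => /andP[].
have DC x y : x \in D -> y \in C -> (x <= y)%O.
  by move=> /tD xv /vC; apply: le_trans.
have CD1 : #|C :&: D| <= 1.
  apply/card_le1_eqP => x y; rewrite !inE => /andP[xC xD] /andP[yC yD].
  by apply: le_anti; rewrite !DC.
rewrite -cardsUI -addn1 leq_add //; apply: chain_card_le; apply/chainP; split.
  rewrite subUset; apply/andP; split; apply/subsetP => // x /CL.
  by rewrite inE => /andP[].
move=> x y /setUP[xC|xD] /setUP[yC|yD].
- exact: cC'.
- by rewrite /Order.comparable (DC y x) ?orbT.
- by rewrite /Order.comparable (DC x y).
- exact: cD'.
Qed.

Lemma not_up_card L v : v \in L -> #|not_up L v| < #|L|.
Proof.
move=> vL; apply: proper_card; rewrite properE (proj1 (not_up_convex _ _)) /=.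
by apply/subsetPn; exists v => //; rewrite inE vL /= lexx.
Qed.

Lemma not_up_level L v h : v \in level L h -> #|level (not_up L v) h| < #|level L h|.
Proof.
move=> vL; apply: proper_card; rewrite properE; apply/andP; split.
  apply/subsetP => x; rewrite inE => /andP[xL hx]; rewrite inE -(not_up_node_height xL) hx.
  by rewrite (subsetP (proj1 (not_up_convex _ _)) _ xL).
by apply/subsetPn; exists v => //; rewrite !inE lexx andbF.
Qed.

Lemma not_up_level_edges L v h : 1 < h -> v \in level L h ->
  #|level_edges (not_up L v) h| < #|level_edges L h|.
Proof.
move=> h1; rewrite inE => /andP[vL /eqP hv].
apply: proper_card; rewrite properE; apply/andP; split.
  apply/subsetP => -[x y]; rewrite !inE /= => /and3P[cxy hx hy].
  have /and4P[yL xL _ _] := cxy.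
  rewrite (convex_covers (not_up_convex _ _) cxy) /=.
  by rewrite -(not_up_node_height xL) -(not_up_node_height yL) hx.
have [|u cu hu] := covers_below vL; first by rewrite hv.
apply/subsetPn; exists (u, v); first by rewrite inE /= cu hu hv eqxx.
by rewrite inE /= /covers [v \in _]inE lexx andbF.
Qed.

(** With equal heights, a maximal chain of [not_up L v] is still maximal in [L], so no node becomes
    critical. *)
Lemma not_up_critical L v h : height (not_up L v) = height L ->
  v \in critical L h -> #|critical (not_up L v) h| < #|critical L h|.
Proof.
move=> eqh vL; apply: proper_card; rewrite properE; apply/andP; split.
  apply/subsetP => x; rewrite !inE => /andP[/andP[xL hx] /existsP[C /andP[/andP[cC hC] xC]]].
  have xL' : x \in not_up L v by rewrite inE.
  rewrite -(not_up_node_height xL') hx andbT; case/andP: (xL) => -> _ /=.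
  apply/existsP; exists C; rewrite /maximal_chain xC -eqh hC !andbT.
  have /chainP[CL _] := cC; apply: (chain_subset _ _ cC) => //.
  by apply: subset_trans CL (proj1 (not_up_convex _ _)).
by apply/subsetPn; exists v => //; rewrite !inE lexx andbF.
Qed.

Lemma up_top_card L v : v \in L -> node_height L v = height L -> #|up L v| = 1.
Proof.
move=> vL hv; apply/eqP/cards1P; exists v; apply/setP => x; rewrite !inE.
apply/andP/eqP => [[xL]|->]; last by rewrite vL lexx.
rewrite le_eqVlt => /orP[/eqP//|/node_height_lt lt].
by have := lt _ vL xL; have := node_height_le L x; lia.
Qed.

End Posets.

(** * The potential of a state *)

Section Strategy.
Context {d : Order.disp_t} {T : finPOrderType d}.
Implicit Types (L mu : {set T}) (v : T) (k l : nat).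

(** An upper bound for the queries still to come. For [n <= k] it is [1 + (n - 1) * l] with one [l]
    replaced by the present size of level 2, from which the next query is taken. *)
Definition potential l L k : nat :=
  let n := height L in
  let m := ceil_div n.+1 k in
  if (#|L| <= 1) || (k == 1) then #|L|
  else if n <= k then #|level L 2| + (1 + n.-2 * l)
  else (if k %| n then #|level_edges L m| else #|critical L m|)
       + query_bound k.-1 l (n.+1 - m).

Lemma potential_few L k l : 1 < #|L| -> 1 < k -> height L <= k ->
  potential l L k = #|level L 2| + (1 + (height L).-2 * l).
Proof. by move=> L1 k1 nk; rewrite /potential leqNgt L1 gtn_eqF // nk. Qed.

Lemma potential_many L k l : 1 < k < height L ->
  potential l L k =
  (if k %| height L then #|level_edges L (ceil_div (height L).+1 k)|
   else #|critical L (ceil_div (height L).+1 k)|)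
  + query_bound k.-1 l ((height L).+1 - ceil_div (height L).+1 k).
Proof.
move=> kB; have := height_le_card L => ?.
rewrite /potential ifF; last by apply/negbTE; rewrite negb_or -ltnNge gtn_eqF; lia.
by rewrite ifF //; lia.
Qed.

Lemma critical_le_level L h : #|critical L h| <= #|level L h|.
Proof. by apply: subset_leq_card; apply/subsetP => v; rewrite inE => /andP[]. Qed.

(** Each count is at most its geometric estimate: the whole poset the sum over its levels, level 2
    at most [l], pairs and critical nodes at most [l ^ m.-1]. In the last case [query_bound_rec]
    adds up the two summands. *)
Lemma potential_le L k l : 0 < k -> pointed L -> degree L <= l ->
  potential l L k <= query_bound k l (height L).
Proof.
move=> k0 pL dL; rewrite /potential.
case: (leqP #|L| 1) => [L1|L1] /=.
  case: (posnP #|L|) => [->//|L0]; apply: leq_trans L1 _.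
  by apply: query_bound_gt0 => //; apply: height_gt0.
case: eqP => [->|k1]; first by rewrite query_bound1 card_le_geometric.
have n1 := height_gt1 pL L1; case: (leqP (height L) k) => [nk|kn].
  apply: leq_trans (query_bound_few _ _); last by rewrite nk ltnW.
  have := level_le 1 pL dL; rewrite expn1.
  have : (height L).-1 * l = l + (height L).-2 * l.
    by rewrite -mulSn; congr (_ * _); lia.
  by move=> ->; rewrite addnCA leq_add2l leq_add2r.
have kB : 1 < k < height L by lia.
have := query_height_bounds kB.
rewrite (query_bound_rec l kB) leq_add2r.
case: (ceil_div _ _) => [|[|m]] //= _.
case: ifP => _; first exact: level_edges_le_exp.
exact: leq_trans (critical_le_level _ _) (level_le _ pL dL).
Qed.

Lemma admissibleP L k v : 0 < k -> pointed L -> 1 < #|L| -> admissible L k v ->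
  v \in L /\
  [\/ k = 1 /\ node_height L v = height L,
      1 < k /\ height L <= k /\ node_height L v = 2
    | 1 < k < height L /\ v \in critical L (ceil_div (height L).+1 k)].
Proof.
move=> k0 pL L1 /andP[vL]; have n1 := height_gt1 pL L1.
case/or3P => [/andP[/eqP-> /eqP->]|/and3P[nk /eqP hv _]|/and3P[kn hv mv]].
- by split=> //; constructor 1.
- by split=> //; constructor 2; split=> //; lia.
- by split=> //; constructor 3; rewrite !inE vL hv.
Qed.

(** A maximal chain meets every height from 1 to [n], and each prescribed query height lies in this
    range. *)
Lemma admissible_exists L k : 0 < k -> pointed L -> 1 < #|L| ->
  exists v, admissible L k v.
Proof.
move=> k0 pL L1; have n1 := height_gt1 pL L1.
have [C mC] := maximal_chain_exists L.
have node h : 0 < h <= height L ->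
    exists v, [/\ v \in L, node_height L v = h & on_maximal_chain L v].
  move=> hB; have [v vC hv] := maximal_chain_level mC hB; exists v; split=> //.
    by case/andP: mC => /chainP[/subsetP CL _] _; apply: CL.
  by apply/existsP; exists C; rewrite mC.
case: (eqVneq k 1) => [->|k1].
  have [|v [vL hv _]] := node (height L); first lia.
  by exists v; rewrite /admissible vL hv !eqxx.
case: (leqP (height L) k) => [nk|kn].
  have [|v [vL hv mv]] := node 2; first lia.
  by exists v; rewrite /admissible vL hv mv nk /= orbT.
have kB : 1 < k < height L by lia.
have := query_height_bounds kB => mB.
have [|v [vL hv mv]] := node (ceil_div (height L).+1 k); first lia.
by exists v; rewrite /admissible vL hv mv kB eqxx /= !orbT.
Qed.

Lemma potential_gt0 L k l v : 0 < k -> pointed L -> 1 < #|L| ->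
  admissible L k v -> 0 < potential l L k.
Proof.
move=> k0 pL L1 /admissibleP[]// vL.
case=> [[-> _]|[k1 [nk _]]|[kB _]].
- by rewrite /potential orbT; lia.
- by rewrite potential_few // add1n addnS.
- rewrite potential_many // addn_gt0 query_bound_gt0 ?orbT //; first lia.
  by have := query_height_bounds kB; lia.
Qed.

(** For [1 < k < n] the second summand of the old potential bounds the new one, and the first is
    positive owing to [v] or a pair below it. For [n <= k] the loss of height frees a term [l],
    which covers the new level 2. For [k = 1] nothing lies above [v]. *)
Lemma potential_up L k l v : 0 < l -> 0 < k -> pointed L -> degree L <= l ->
  1 < #|L| -> admissible L k v -> #|up L v| != 1 ->
  1 < k /\ potential l (up L v) k.-1 < potential l L k.
Proof.
move=> l0 k0 pL dL L1 /admissibleP[]// vL adm U1.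
have hU := up_height vL; have pU := up_pointed vL.
have dU : degree (up L v) <= l := leq_trans (convex_degree (up_convex L v)) dL.
have U2 : 1 < #|up L v|.
  suff : 0 < #|up L v| by lia.
  by apply/card_gt0P; exists v; rewrite inE vL /=.
have nU := height_gt1 pU U2.
case: adm => [[_ hv]|[k1 [nk hv]]|[kB vcr]].
- by move: U1; rewrite up_top_card.
- split=> //; rewrite !potential_few //; [|lia|lia].
  have vl : 0 < #|level L 2| by apply/card_gt0P; exists v; rewrite inE vL hv.
  have := level_le 1 pU dU; rewrite expn1.
  have : (height (up L v)).-2.+1 * l <= (height L).-2 * l by rewrite leq_mul2r; lia.
  rewrite mulSn; move: (_.-2 * l) (_.-2 * l); lia.
split; first lia.
have hv : node_height L v = ceil_div (height L).+1 k.
  by move: vcr; rewrite !inE => /andP[/andP[_ /eqP]].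
have : potential l (up L v) k.-1 <=
       query_bound k.-1 l ((height L).+1 - ceil_div (height L).+1 k).
  apply: leq_trans (potential_le _ pU dU) _; first lia.
  by apply: query_bound_mono => //; lia.
rewrite (potential_many l kB) => H; rewrite -add1n leq_add //; case: ifP => _; last first.
  by apply/card_gt0P; exists v.
have := query_height_bounds kB; case: (ceil_div _ _) vcr {H hv} => [|[|m]] // vcr _.
apply: leq_trans (level_le_edges _ _); apply/card_gt0P; exists v.
by move: vcr; rewrite inE => /andP[].
Qed.

Lemma potential_not_up_large L k l v : 0 < l -> pointed L -> degree L <= l ->
  1 < k < height L -> v \in critical L (ceil_div (height L).+1 k) ->
  potential l (not_up L v) k <
  (if k %| height L then #|level_edges L (ceil_div (height L).+1 k)|
   else #|critical L (ceil_div (height L).+1 k)|)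
  + query_bound k.-1 l ((height L).+1 - ceil_div (height L).+1 k).
Proof.
set n := height L; set m := ceil_div n.+1 k; set Q := query_bound k.-1 l _.
set e := if _ then _ else _; set L' := not_up L v => l0 pL dL kB vcr.
have [k1 kn] := andP kB; have mB := query_height_bounds kB; rewrite -/m in mB.
have vlev : v \in level L m by move: vcr; rewrite inE => /andP[].
have pL' : pointed L' by apply: not_up_pointed.
have dL' : degree L' <= l := leq_trans (convex_degree (not_up_convex L v)) dL.
have nn : height L' <= n by apply: height_subset; case: (not_up_convex L v).
have edges_lt : #|level_edges L' m| < #|level_edges L m|.
  by apply: not_up_level_edges => //; case/andP: mB.
have e0 : 0 < e.
  rewrite /e; case: ifP => _; first by lia.
  by apply/card_gt0P; exists v.
(* The positive summand [e] pays for the query once the new bound fits into [Q]. *)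
have drop : query_bound k l (height L') <= Q -> potential l L' k < e + Q.
  move=> bQ; rewrite -add1n leq_add //; apply: leq_trans bQ.
  by apply: potential_le => //; lia.
(* At unchanged height, [m] and [Q] stay the same and the count loses [v] or a pair below it. *)
case: (eqVneq (height L') n) => [nE|nE].
  rewrite potential_many nE // -/m -/Q ltn_add2r /e; case: ifP => // _.
  exact: not_up_critical.
have n'n : height L' < n by lia.
case: (eqVneq l 1) => [l1|l1].
  apply: drop; rewrite /Q l1; apply: query_bound_drop_unary => //; rewrite -/m.
  (* Level [m] of [L] has at most one node, namely [v]; a height of at least [m] would leave another
     one in [L']. *)
  rewrite ltnNge; apply/negP => mn'.
  have [C mC] := maximal_chain_exists L'.
  have [|u uC hu] := maximal_chain_level (h := m) mC; first lia.
  have uL' : u \in L' by case/andP: mC => /chainP[/subsetP CL _] _; apply: CL.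
  have := not_up_level vlev; have : 0 < #|level L' m|.
    by apply/card_gt0P; exists u; rewrite inE uL' hu /=.
  have := level_le m.-1 pL dL; rewrite l1 exp1n prednK; last lia.
  by rewrite -/L'; lia.
case: (ltnP (height L' + (k %| n)) n) => [lt|ge].
  by apply: drop; apply: query_bound_drop => //; lia.
(* Only height [n - 1] with [k] dividing [n] remains. The new query height is [q = m - 1], and [Q]
   is unchanged because [n - q = n + 1 - m]. *)
have kdn : k %| n by case: (k %| n) ge => //; lia.
have n'E : (height L').+1 = n by move: ge; rewrite kdn; lia.
have /dvdnP[q nq] := kdn.
have mE : m = q.+1 by apply: ceil_divE; nia.
have qE : ceil_div (height L').+1 k = q by rewrite n'E; apply: ceil_divE; nia.
have q2 : 1 < q by nia.
have kn' : k < height L' by nia.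
have nkd : k %| height L' = false.
  by apply/negP => kd'; move: kdn; rewrite -n'E -addn1 dvdn_addr // dvdn1; lia.
rewrite potential_many ?nkd ?qE ?k1 // n'E.
have -> : n - q = n.+1 - m by lia.
rewrite ltn_add2r /e kdn; apply: leq_ltn_trans edges_lt; rewrite mE.
by apply: critical_le_edges; nia.
Qed.

Lemma potential_not_up L k l v : 0 < l -> 0 < k -> pointed L -> degree L <= l ->
  1 < #|L| -> admissible L k v -> potential l (not_up L v) k < potential l L k.
Proof.
move=> l0 k0 pL dL L1 /admissibleP[]// vL.
have nn : height (not_up L v) <= height L.
  by apply: height_subset; case: (not_up_convex L v).
case=> [[-> _]|[k1 [nk hv]]|[kB vcr]].
- by rewrite /potential eqxx !orbT not_up_card.
- have vlev : v \in level L 2 by rewrite inE vL hv /=.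
  have lt := not_up_level vlev; rewrite [potential l L k]potential_few //.
  case: (leqP #|not_up L v| 1) => [L'1|L'1].
    rewrite /potential L'1 /= (leq_ltn_trans L'1) // add1n addnS ltnS addn_gt0.
    by rewrite (leq_ltn_trans (leq0n _) lt).
  rewrite potential_few ?(leq_trans nn) // -addSn leq_add // leq_add2l leq_mul2r; lia.
by rewrite [potential l L k]potential_many //; apply: potential_not_up_large.
Qed.

(** * Invariants of rounds and runs *)

Definition state_potential l (s : @state d T) : nat :=
  if s is Active L k then potential l L k else 0.

Definition allowance (s : @state d T) : nat :=
  if s is Active _ k then k else 0.

(** The generator of a nonempty [mu] stays in the current [L], whereas its ideal is formed in the
    whole poset, as the answer is. The degree is only bounded, since it may fall. *)
Definition invariant mu l (s : @state d T) : Prop :=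
  match s with
  | Active L k => [/\ 0 < k, pointed L, degree L <= l &
      mu = set0 \/ exists2 w, w \in L & mu = down [set: T] w]
  | Answer A => A = mu
  end.

Lemma round_step mu l s q s' : 0 < l -> invariant mu l s ->
  round [set: T] (mem mu) s q s' ->
  [/\ invariant mu l s', positive_queries q + allowance s' <= allowance s &
      total_queries q + state_potential l s' <= state_potential l s].
Proof.
move=> l0 inv r; case: r inv => {s q s'} [k|v k|L k v L1 adm vmu|L k v L1 adm vmu] /=.
- case=> k0 _ _ [->|[w]]; first by [].
  by rewrite inE.
- case=> k0 _ _ muE; split; last by rewrite /potential cards1.
    case: muE => [->|[w /set1P-> ->]]; first by rewrite inE.
    by rewrite !inE /= lexx.
  by rewrite /positive_queries /=; case: (v \in mu).
- have {}vmu : v \in mu := vmu; case=> k0 pL dL muE.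
  have [vL _] := admissibleP k0 pL L1 adm.
  have [w [wL vw {}muE]] :
      exists w, [/\ w \in L, (v <= w)%O & mu = down [set: T] w].
    case: muE vmu => [->|[w wL ->]]; first by rewrite inE.
    by rewrite !inE => vw; exists w.
  case: eqP => [U1|/eqP U1].
    split; rewrite /= ?addn0 //; last exact: potential_gt0 adm.
    (* The singleton [up L v] contains both [v] and the generator [w], so they coincide. *)
    have /cards1P[x xE] : #|up L v| == 1 by apply/eqP.
    have : v \in up L v by rewrite inE vL /=.
    have : w \in up L v by rewrite inE wL vw.
    by rewrite xE muE => /set1P-> /set1P->.
  have [k1 lt] := potential_up l0 k0 pL dL L1 adm U1.
  split=> //=; last by rewrite /positive_queries /=; lia.
  split; [lia|exact: up_pointed|exact: leq_trans (convex_degree (up_convex L v)) dL|].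
  by right; exists w => //; rewrite inE wL vw.
- have {}vmu : v \notin mu := vmu; case=> k0 pL dL muE; split=> //=; last exact: potential_not_up.
  split=> //; first exact: not_up_pointed.
    exact: leq_trans (convex_degree (not_up_convex L v)) dL.
  case: muE vmu => [->|[w wL ->]]; [by left|rewrite !inE /= => nvw; right].
  by exists w => //; rewrite inE wL.
Qed.

(** The only round without a query ends in an answer. Hence the potential drops strictly in every
    round that continues, which gives termination. *)
Lemma round_size_active L0 o s q L k :
  @round d T L0 o s q (Active L k) -> total_queries q = 1.
Proof.
move E: (Active L k) => s' r; case: r E => //.
Qed.

Lemma round_total mu l L k : invariant mu l (Active L k) ->
  exists q s', round [set: T] (mem mu) (Active L k) q s'.
Proof.
case=> k0 pL _ _; case: (ltngtP #|L| 1) => [L0|L1|/eqP/cards1P[v ->]].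
- have -> : L = set0 by apply: cards0_eq; lia.
  by exists [::], (Answer set0); constructor.
- have [v adm] := admissible_exists k0 pL L1.
  case vmu: (v \in mu).
    by do 2!eexists; apply: RoundPos adm _ => //; rewrite /= vmu.
  by do 2!eexists; apply: RoundNeg adm _ => //; rewrite /= vmu.
by do 2!eexists; apply: RoundSingle.
Qed.

Lemma invariant_terminates mu l s : 0 < l -> invariant mu l s ->
  Acc (fun s' s => exists q, round [set: T] (mem mu) s q s') s.
Proof.
move=> l0; have [N] := ubnP (state_potential l s).
elim: N s => [s|N IH s sN inv]; first by rewrite ltn0.
apply: Acc_intro => -[L k|A] [q r].
  have [inv' _ lt] := round_step l0 inv r.
  by apply: IH => //; have := round_size_active r; lia.
apply: Acc_intro => s' [q' r']; move E: (Answer A) r' => sA r'.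
by case: r' E.
Qed.

Lemma run_step mu l k h s : 0 < l -> invariant mu l (Active [set: T] k) ->
  run [set: T] k (mem mu) h s ->
  [/\ invariant mu l s, positive_queries h + allowance s <= k &
      total_queries h + state_potential l s <= potential l [set: T] k].
Proof.
move=> l0 inv0; elim=> [|{}h {}s q s' _ [inv posh toth] r]; first by [].
have [inv' posq totq] := round_step l0 inv r; split=> //.
  by move: posh posq; rewrite /positive_queries count_cat; lia.
by move: toth totq; rewrite /total_queries size_cat; lia.
Qed.

(** For [l = 0] the geometric bound on the size is at most [0 ^ 0 = 1]. *)
Lemma height_le1_degree0 L : pointed L -> degree L = 0 -> height L <= 1.
Proof.
move=> pL dL; apply: leq_trans (height_le_card L) _.
have := @card_le_geometric _ _ L 0 pL; rewrite dL => /(_ isT)/leq_trans; apply.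
case: (height L) => [|n]; first by rewrite big_geq.
by rewrite big_nat_recl // big1 // => i _; rewrite exp0n.
Qed.

End Strategy.

Theorem theoremA (d : Order.disp_t) (T : finPOrderType d) (k l n : nat)
    (k_gt0 : 0 < k)
    (pointedT : pointed [set: T])
    (degreeT : degree [set: T] = l)
    (heightT : height [set: T] = n) :
  (forall mu : {set T}, ideal [set: T] mu ->
     strategy_identifies [set: T] k mu /\
     (forall (h : seq (T * bool)) (s : state),
        run [set: T] k (mem mu) h s ->
        positive_queries h <= k /\ total_queries h <= query_bound k l n)) /\
  (l = 1 -> query_bound k l n <= ceil_div n k + k - 1) /\
  (1 < l -> query_bound k l n <= k * l ^ ceil_div n k).
Proof.
split; last first.
  by split=> [->|l1]; [rewrite query_bound_unary; lia|apply: query_bound_le].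
(* The potential argument uses a positive degree bound. For [l = 0] the height is at most 1, and
   [l' = 1] gives the same query bound. *)
move=> mu idmu; have [l' l'0 ll'] : exists2 l', 0 < l' &
    l <= l' /\ query_bound k l' n = query_bound k l n.
  case: (posnP l) => [lE|l0]; last by exists l.
  exists 1 => //; split; first by rewrite lE.
  by apply: query_bound_degenerate => //; rewrite -heightT height_le1_degree0 // degreeT.
have [ll boundE] := ll'.
have inv0 : invariant mu l' (Active [set: T] k) by split; rewrite ?degreeT.
split=> [|h s /(run_step l'0 inv0)[_ posh toth]].
  split; first exact: invariant_terminates inv0.
  move=> h [L m|A] /(run_step l'0 inv0)[inv _ _]; last by left; rewrite inv.
  by right; apply: round_total inv.
split; first lia.
rewrite -boundE -heightT.
have := @potential_le _ _ [set: T] k l' k_gt0 pointedT; rewrite degreeT => /(_ ll).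
lia.
Qed.
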